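(* Let $(G,T)$ be an odd transposition group and let $G$ have a bounded period (i.e. there is a positive integer $N$ with $g^N=1$ for all $g\in G$). If $G/Z(G)$ is a finite group and $T$ is a finite set, then $G$ is a finite group.
   Context: A pair $(G,T)$ is called an odd transposition group if $G$ is a group, $T$ is a normal (conjugation-invariant) set of involutions of $G$, $G=\langle T\rangle$, and for any two distinct $u,v\in T$ the order $|uv|$ is either $2$ or an odd positive integer. $Z(G)$ is the center of $G$. *)

(* Defs.v *)
From mathcomp Require Import all_boot.
From mathcomp Require Import boolp classical_sets functions cardinality.

Set Implicit Arguments.
Unset Strict Implicit.
Unset Printing Implicit Defensive.

Local Open Scope classical_set_scope.
Local Open Scope group_scope.

(* Groups are MathComp's [groupType]s, which may be infinite. An element of
   infinite order satisfies [has_order g n] for no [n]. *)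
Definition has_order (G : groupType) (g : G) (n : nat) : Prop :=
  [/\ (0 < n)%N, g ^+ n = 1
    & forall m : nat, (0 < m)%N -> g ^+ m = 1 -> (n <= m)%N].

Definition involution (G : groupType) (t : G) : Prop := has_order t 2.

Definition subgroup (G : groupType) (H : set G) : Prop := group_closed [in H].

Definition generated (G : groupType) (T : set G) : set G :=
  smallest (@subgroup G) T.

Definition center (G : groupType) : set G :=
  [set z | forall g : G, commute z g].
Arguments center : clear implicits.

(* Since the center is normal, its left cosets are the elements of G/Z(G). *)
Definition center_quotient (G : groupType) : set (set G) :=
  [set [set g * z | z in center G] | g in [set: G]].
Arguments center_quotient : clear implicits.

Record odd_transposition_group (G : groupType) (T : set G) : Prop := {
  otg_involution : forall t : G, T t -> involution t;
  otg_normal : forall t g : G, T t -> T (t ^ g);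
  otg_generated : generated T = [set: G];
  otg_order : forall u v : G, T u -> T v -> u <> v ->
    exists n : nat, has_order (u * v) n /\ (n = 2 \/ odd n)
}.

Definition bounded_period (G : groupType) : Prop :=
  exists N : nat, (0 < N)%N /\ forall g : G, g ^+ N = 1.

(* Main.v *)
Require Import Defs.
From mathcomp Require Import all_boot.
From mathcomp Require Import boolp classical_sets functions cardinality.

Local Open Scope classical_set_scope.
Local Open Scope group_scope.

(** The theorem is the involution case of Dietzmann's lemma: a finite
    conjugation-invariant set [T] of involutions generates a finite group.

    Since involutions are their own inverses, every element of [G] is the
    product of a word in [T] ([generated_by_words]). In such a word a repeated
    letter can be cancelled: [t a t] is the conjugate [a ^ t], and because [T]
    is normal it is spelled by the word obtained from that of [a] by
    conjugating every letter ([shorten_word]). Each cancellation saves two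
    letters, so every element of [G] is the product of a word without repeated
    letters ([word_uniq]). Such a word is no longer than the number of elements
    of [T], and a finite alphabet has only finitely many words of bounded
    length ([finite_words]). *)

Lemma not_uniq_split (A : eqType) (s : seq A) :
  ~~ uniq s -> exists t s1 s2 s3, s = s1 ++ t :: s2 ++ t :: s3.
Proof.
elim: s => [//|x s IH] /=; rewrite negb_and negbK.
case/orP => [/splitPr [p q]|/IH [t [s1 [s2 [s3 ->]]]]].
  by exists x, [::], p, q.
by exists t, (x :: s1), s2, s3.
Qed.

Lemma finite_words (A : eqType) (T : set A) (n : nat) : finite_set T ->
  finite_set [set s : seq A | [set` s] `<=` T /\ (size s <= n)%N].
Proof.
move=> finT; elim: n => [|n IH].
  apply: (@sub_finite_set _ _ [set [::]]) => [s [_]|]; last exact: finite_set1.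
  by rewrite leqn0 => /nilP.
apply: (@sub_finite_set _ _ ([set [::]] `|`
    [set x :: s | x in T & s in [set s | [set` s] `<=` T /\ (size s <= n)%N]])).
  move=> [|x s] [sT ns]; [by left | right].
  exists x; first by apply: sT; rewrite /= mem_head.
  exists s => //; split=> // y ys; apply: sT.
  by rewrite /= inE; apply/orP; right.
by rewrite finite_setU; split; [exact: finite_set1 | exact: finite_image2].
Qed.

Section NormalInvolutions.

Variables (G : groupType) (T : set G).
Hypothesis sqT : forall t, T t -> t * t = 1.
Hypothesis normT : forall t g, T t -> T (t ^ g).

(** These products already form a subgroup: the inverse of a word in
    involutions is the same word read backwards. *)
Lemma generated_by_words (g : G) : generated T g ->
  exists2 s : seq G, [set` s] `<=` T & g = \prod_(x <- s) x.
Proof.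
pose W := [set g | exists2 s : seq G, [set` s] `<=` T & g = \prod_(x <- s) x].
apply: (@smallest_sub _ _ _ W) => [|t Tt]; last first.
  exists [:: t]; last by rewrite big_seq1.
  by move=> x; rewrite /= inE => /eqP ->.
split=> [|u v]; first by rewrite inE; exists [::]; rewrite ?big_nil.
rewrite !inE => -[s sT ->] [r rT ->]; exists (s ++ rev r) => [x|].
  by rewrite /= mem_cat mem_rev => /orP[/sT|/rT].
rewrite big_cat; congr (_ * _); rewrite -[in LHS](revK r) -prodgV.
apply: eq_big_seq => x; rewrite mem_rev => /rT Tx.
by apply: (mulgI x); rewrite mulgV sqT.
Qed.

(** A repeated letter [t] is cancelled by conjugating by [t] all the letters
    between its two occurrences. *)
Lemma shorten_word (s : seq G) : [set` s] `<=` T -> ~~ uniq s ->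
  exists r : seq G, [/\ [set` r] `<=` T, (size r < size s)%N
    & \prod_(x <- s) x = \prod_(x <- r) x].
Proof.
move=> sT /not_uniq_split[t [s1 [s2 [s3 def_s]]]].
have Tt : T t by apply: sT; rewrite def_s /= mem_cat mem_head orbT.
exists (s1 ++ map (conjg^~ t) s2 ++ s3); split.
- move=> x; rewrite /= !mem_cat => /or3P[xs|/mapP[y ys ->]|xs].
  + by apply: sT; rewrite def_s /= mem_cat xs.
  + by apply/normT/sT; rewrite def_s /= !(mem_cat, inE) ys !orbT.
  + by apply: sT; rewrite def_s /= !(mem_cat, inE) xs !orbT.
- by rewrite def_s !(size_cat, size_map) /= !size_cat
    /= ltn_add2l ltnS leq_add2l leqnSn.
have tV : t^-1 = t by apply: (mulgI t); rewrite mulgV sqT.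
rewrite def_s !(big_cat, big_cons) /= big_map -conjg_prod conjgE tV.
by rewrite /= !mulgA.
Qed.

Lemma word_uniq (s : seq G) : [set` s] `<=` T ->
  exists r : seq G, [/\ [set` r] `<=` T, uniq r
    & \prod_(x <- s) x = \prod_(x <- r) x].
Proof.
have [n] := ubnP (size s); elim: n s => // n IH s /ltnSE sn sT.
case: (boolP (uniq s)) => [us|/(shorten_word _ sT)[r [rT rs ->]]].
  by exists s.
exact: IH (leq_trans rs sn) rT.
Qed.

(** By pigeonhole a word without repeated letters is no longer than any list
    of the letters, so finitely many words spell out the whole subgroup. *)
Lemma finite_generated : finite_set T -> finite_set (generated T).
Proof.
move=> finT; have /finite_seqP[l def_T] := finT.
apply: (sub_finite_set _ (finite_image (fun s => \prod_(x <- s) x)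
  (finite_words _ _ (size l) finT))).
move=> _ /generated_by_words[s /word_uniq[r [rT ur ->]] ->].
exists r => //; split=> //; apply: uniq_leq_size => // x /rT.
by rewrite def_T.
Qed.

End NormalInvolutions.

Theorem theorem2 (G : groupType) (T : set G)
    (hGT : odd_transposition_group T) (hper : bounded_period G)
    (hquot : finite_set (center_quotient G)) (hT : finite_set T) :
  finite_set [set: G].
Proof.
rewrite -(otg_generated hGT); apply: finite_generated hT => [t Tt|].
  by have [_] := otg_involution hGT Tt; rewrite expgS expg1.
exact: otg_normal hGT.
Qed.
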